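(* For integers $3\le k\le n$, \[ \mathbb{E}_3(k,n)\le\frac{2k}{3n}\bigl(1+O(1/k)\bigr). \]
   Context: A $k\times n$ Latin rectangle (with $k\le n$ positive integers) is a $k\times n$ matrix on $n$ symbols (the symbol set is $[n]=\{1,\dots,n\}$), each of which occurs at most once in each row and column. A subsquare of order $m$ of a Latin rectangle $L$ is an $m\times m$ submatrix of $L$ (induced by a set of $m$ rows and a set of $m$ columns, not necessarily contiguous) which is itself a Latin square, i.e. contains exactly $m$ distinct symbols. For an integer $2\le m\le n/2$, $\mathbb{E}_m(k,n)$ denotes the expected number of subsquares of order $m$ in a uniformly random $k\times n$ Latin rectangle. Asymptotics are as $n\to\infty$, with $k$ an arbitrary integer function of $n$ (here with $3\le k\le n$); $O(1/k)$ denotes a quantity bounded in absolute value by a constant times $1/k$ for all sufficiently large $n$. *)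

(* Defs.v *)
From mathcomp Require Import all_boot all_order all_algebra.

Set Implicit Arguments.
Unset Strict Implicit.
Unset Printing Implicit Defensive.

Import Order.TTheory GRing.Theory Num.Theory.

Local Open Scope ring_scope.

(* The symbol set [n] is 'I_n = {0, ..., n-1}. *)
Definition latin_rectangle (k n : nat) (L : 'M['I_n]_(k, n)) : bool :=
  [forall i : 'I_k, forall s : 'I_n, (#|[set j | L i j == s]| <= 1)%N] &&
  [forall j : 'I_n, forall s : 'I_n, (#|[set i | L i j == s]| <= 1)%N].

(* In a Latin rectangle an m x m submatrix is a Latin square exactly when it
   contains m distinct symbols. *)
Definition is_subsquare (m k n : nat) (L : 'M['I_n]_(k, n))
    (A : {set 'I_k}) (B : {set 'I_n}) : bool :=
  [&& #|A| == m, #|B| == m & #|[set L i j | i in A, j in B]| == m].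

Definition num_subsquares (m k n : nat) (L : 'M['I_n]_(k, n)) : nat :=
  #|[set AB : {set 'I_k} * {set 'I_n} | is_subsquare m L AB.1 AB.2]|.

Definition expected_subsquares (R : realFieldType) (m k n : nat) : R :=
  (\sum_(L : 'M['I_n]_(k, n) | latin_rectangle L) (num_subsquares m L)%:R)
  / #|[set L : 'M['I_n]_(k, n) | latin_rectangle L]|%:R.

(* Main.v *)
Require Import Defs.
From mathcomp Require Import all_boot all_order all_algebra all_fingroup.
From mathcomp Require Import all_solvable zify ring.

Set Implicit Arguments.
Unset Strict Implicit.
Unset Printing Implicit Defensive.

Import Order.TTheory GRing.Theory Num.Theory.

Local Open Scope ring_scope.

(* Compare the numbers of three nested structures over all Latin rectangles:
   subsquares of order 3, subsquares with one cell spoilt, and pairs of rows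
   with a 3-cycle.
   Two columns c, c' of L form a graph on the rows, r ~ s when L r c = L s c';
   exchanging the columns on one component keeps L Latin, and so does the same
   operation with rows and columns interchanged.  Such an exchange destroys one
   structure, and what is left over determines where the exchange took place,
   so the first structure is rarer than what is left by about the number of
   choices for the second line (n - 3 columns or k - 3 rows).  The exchange is
   blocked when several rows of the structure lie in one component; but
   permuting the contents of the structure itself changes how these rows are
   joined, and some arrangement (1 of 2, or 1 of 3) always isolates the required
   row.  This loses a constant factor only and gives
   3 (n - 3)^2 * (number of subsquares) <= 2 k n * (number of rectangles). *)

(** * Counting by injections and by coverings *)

Lemma card_dep_pairs (T1 T2 : finType) (A : {set T1}) (Q : T1 -> {set T2}) m :
  {in A, forall a, #|Q a| = m} ->
  #|[set p : T1 * T2 | (p.1 \in A) && (p.2 \in Q p.1)]| = (#|A| * m)%N.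
Proof.
move=> Qm; rewrite -sum1dep_card.
rewrite -(pair_big_dep (mem A) (fun a b => b \in Q a) (fun _ _ => 1%N)) /=.
under eq_bigr => a Aa do rewrite sum1_card Qm //.
by rewrite sum_nat_const.
Qed.

Lemma leq_card_inj_in (T S : finType) (F : T -> S) (A : {set T}) (B : {set S}) :
  {in A, forall x, F x \in B} -> {in A &, injective F} -> (#|A| <= #|B|)%N.
Proof.
move=> AB F_inj; rewrite -(card_in_imset F_inj).
by apply/subset_leq_card/subsetP=> _ /imsetP[x Ax ->]; exact: AB.
Qed.

(** Pairing [phi i x] with an index [i] for which it lies in [P] embeds [X] into [I * P]. Below, the
    [phi i] are rearrangements of a structure and [P] collects the configurations in which the
    exchange is not blocked. *)
Lemma leq_card_cover (T I : finType) (X P : {set T}) (phi : I -> T -> T) :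
  (forall i, {in X &, injective (phi i)}) ->
  {in X, forall x, exists i, phi i x \in P} -> (#|X| <= #|I| * #|P|)%N.
Proof.
move=> phi_inj XP.
have some_inj : injective (@Some (I * T)%type) by move=> ? ? [].
pose F x := omap (fun i => (i, phi i x)) [pick i | phi i x \in P].
have FE x : x \in X -> exists2 i, phi i x \in P & F x = Some (i, phi i x).
  move=> Xx; rewrite /F; case: pickP => [i Pi | noP]; first by exists i.
  by have [i] := XP x Xx; rewrite noP.
rewrite -cardsT -cardsX -(card_imset _ some_inj).
apply: (leq_card_inj_in (F := F)) => [x /FE[i Pi ->] | x y Xx Xy].
  by rewrite imset_f // !inE.
have [[i _ ->] [j _ ->]] := (FE x Xx, FE y Xy).
by case=> -> /phi_inj; apply.
Qed.

(** * Exchanging two injections on a component *)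

Definition mates (T S : finType) (f g : T -> S) : rel T :=
  [rel x y | (f x == g y) || (g x == f y)].

Definition component (T S : finType) (f g : T -> S) (x : T) : {set T} :=
  [set y | connect (mates f g) x y].

Definition exchange (T S : finType) (f g : T -> S) (D : {set T}) (x : T) : S :=
  if x \in D then g x else f x.

Definition mates_closed (T S : finType) (f g : T -> S) (D : {set T}) :=
  forall x y, f x = g y -> (x \in D) = (y \in D).

Section Mates.
Variables (T S : finType) (f g : T -> S).

Lemma connect_mates_sym : connect_sym (mates f g).
Proof.
by apply: sym_connect_sym => x y; rewrite /mates /= orbC ![f _ == _]eq_sym.
Qed.

Lemma component_sym x y : (y \in component f g x) = (x \in component f g y).
Proof. by rewrite !inE connect_mates_sym. Qed.

Lemma component_refl x : x \in component f g x.
Proof. by rewrite inE connect0. Qed.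

Lemma component_closed x : mates_closed f g (component f g x).
Proof.
move=> y z fygz; rewrite !inE; apply: (same_connect_r connect_mates_sym).
by apply: connect1; rewrite /mates /= fygz eqxx.
Qed.

Lemma component_min x (D : {set T}) :
  mates_closed f g D -> x \in D -> component f g x \subset D.
Proof.
move=> clD xD; apply/subsetP=> y; rewrite inE => xy.
rewrite -(@closed_connect T (mates f g) (mem D) _ x y xy) //.
by rewrite /mates => u v /= /orP[/eqP/clD // | /eqP/esym/clD].
Qed.

(** [f] and [g] take equally many values on [D], so the inclusion of [f @: D] in [g @: D] is an
    equality; an edge [f x = g y] then has both ends in [D] or neither. *)
Lemma mates_closed_imset (D : {set T}) :
  injective f -> injective g -> {in D, forall x, exists2 y, y \in D & f x = g y} ->
  mates_closed f g D.
Proof.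
move=> f_inj g_inj fD.
have fgD : f @: D = g @: D.
  apply/eqP; rewrite eqEcard !card_imset // leqnn andbT.
  apply/subsetP=> _ /imsetP[x /fD[y yD ->] ->]; exact: imset_f.
by move=> x y fxgy; rewrite -(mem_imset D _ f_inj) fgD fxgy mem_imset.
Qed.

Lemma mates_closedC (D : {set T}) :
  mates_closed f g D -> mates_closed g f D.
Proof. by move=> clD x y /esym/clD. Qed.

End Mates.

Section Exchange.
Variables (T S : finType) (f g : T -> S) (D : {set T}).
Hypotheses (f_inj : injective f) (g_inj : injective g).
Hypothesis (clD : mates_closed f g D).

(** A collision between a point of [D] and a point outside would be an edge leaving [D]. *)
Lemma exchange_inj : injective (exchange f g D).
Proof.
move=> x y; rewrite /exchange; case: ifPn => xD; case: ifPn => yD.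
- exact: g_inj.
- by move=> /esym/clD; rewrite xD (negPf yD).
- by move=> /clD; rewrite yD (negPf xD).
- exact: f_inj.
Qed.

(** Inside [D] the two maps trade roles, which preserves the symmetric edge relation. Edges across
    the boundary of [D] are excluded before the exchange by closedness and after it by injectivity.
    Hence the component can be recomputed from the result and the exchange undone. *)
Lemma component_exchange x :
  component (exchange f g D) (exchange g f D) x = component f g x.
Proof.
apply/setP=> y; rewrite !inE; apply: eq_connect => u v; rewrite /mates /= /exchange.
have E a b : f a = f b -> (a \in D) = (b \in D) by move=> /f_inj->.
have E' a b : g a = g b -> (a \in D) = (b \in D) by move=> /g_inj->.
case: ifPn => uD; case: ifPn => vD //; first exact: orbC.
  apply/idP/idP => /orP[]/eqP.
  - by move=> /E'; rewrite uD (negPf vD).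
  - by move=> /E; rewrite uD (negPf vD).
  - by move=> /clD; rewrite uD (negPf vD).
  - by move=> /esym/clD; rewrite uD (negPf vD).
apply/idP/idP => /orP[]/eqP.
- by move=> /E; rewrite vD (negPf uD).
- by move=> /E'; rewrite vD (negPf uD).
- by move=> /clD; rewrite vD (negPf uD).
- by move=> /esym/clD; rewrite vD (negPf uD).
Qed.

End Exchange.

(** * Isolating a point by rearranging values *)

Lemma extend_injections (T S : finType) (f g : T -> S) :
  injective f -> injective g -> exists p : {perm S}, forall x, p (f x) = g x.
Proof.
move=> f_inj g_inj.
have leTS : (#|T| <= #|S|)%N by exact: leq_card f_inj.
have tr := ntransitive_weak leTS (Sym_trans S).
pose tup (h : T -> S) := mktuple (fun i : 'I_#|T| => h (enum_val i)).
have tupP h : injective h -> tup h \in (#|T|).-dtuple([set: S]).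
  move=> h_inj; apply/dtuple_onP; split=> // i j.
  by rewrite !tnth_mktuple => /h_inj/enum_val_inj.
have [p _ pE] := atransP2 tr (tupP f f_inj) (tupP g g_inj).
exists p => x; have := congr1 (fun t => tnth t (enum_rank x)) pE.
by rewrite tnth_mktuple tnth_map tnth_mktuple enum_rankK => ->.
Qed.

(* Extend the partial map f x |-> g x to a permutation p of the symbols and
   follow p from f r until it first returns to f @: A, say at f a.  If the
   values of f on A are rearranged so that r receives f a, then the walk closes
   up at r without meeting A again. *)
Lemma isolating_value (T S : finType) (f g : T -> S) (A : {set T}) (r : T) :
  injective f -> injective g -> r \in A ->
  exists2 a, a \in A & forall f' : T -> S,
    injective f' -> f' r = f a -> {in [predC A], f' =1 f} ->
    {in A, forall x, f' x \in f @: A} ->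
    {in A, forall x, x \in component f' g r -> x = r}.
Proof.
move=> f_inj g_inj rA; have [p pE] := extend_injections f_inj g_inj.
(* The walk is back at [f r] itself after [#[p]] steps, so a first return exists. *)
have ex_ret : exists m, (p ^+ m.+1)%g (f r) \in f @: A.
  exists #[p].-1%g; rewrite prednK ?order_gt0 // expg_order perm1.
  exact: imset_f.
case: (ex_minnP ex_ret) => m /imsetP[a aA pa] m_min.
exists a => // f' f'_inj f'r f'C f'A.
(* The index shift makes the walk start at [y 0 = g r]; [W] runs from there to the first return
   [y m = f a]. *)
pose y i := (p ^+ i.+1)%g (f r).
have y0 : y 0 = g r by rewrite /y expg1 pE.
have yS i : y i.+1 = p (y i) by rewrite /y expgSr permM.
have ym : y m = f a by [].
have yNA i : (i < m)%N -> y i \notin f @: A.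
  by move=> lt_im; apply: contraL lt_im => /m_min; rewrite -leqNgt.
pose W := [set y (i : 'I_m.+1) | i : 'I_m.+1].
have yW i : (i <= m)%N -> y i \in W.
  by move=> le_im; apply/imsetP; exists (inord i); rewrite // inordK.
have WP z : z \in W -> exists2 i, (i <= m)%N & z = y i.
  by move=> /imsetP[i _ ->]; exists i; rewrite // -ltnS.
have f_in x : x \in A -> f x \in W -> f x = f a.
  move=> xA /WP[i]; rewrite leq_eqVlt => /orP[/eqP-> -> //| /yNA yN fx].
  by case/negP: yN; rewrite -fx imset_f.
have g_in x : g x \in W -> x = r \/ x \notin A /\ f x \in W.
  move=> /WP[[|i] le_im gx]; first by left; apply: g_inj; rewrite gx y0.
  right; have fx : f x = y i by apply: (@perm_inj _ p); rewrite pE gx yS.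
  split; last by rewrite fx yW // ltnW.
  by apply: contra (yNA i le_im) => xA; rewrite -fx imset_f.
have gr : g r \in W by rewrite -y0 yW.
have f'r_in : f' r \in W by rewrite f'r -ym yW.
(* On [A], both [f'] and [g] meet [W] only at [r]: [f a] is the only value of [f] on [A] lying in
   [W], and [g x = y i.+1] forces [f x = y i], outside [f @: A]. Off [A], [f' = f] and [p] moves
   [f x] to [g x], never past the end [f a] of the walk. *)
have fg x : (f' x \in W) = (g x \in W).
  have [->|xr] := eqVneq x r; first by rewrite gr.
  have [xA|xA] := boolP (x \in A); apply/idP/idP.
  - have /imsetP[z zA fz] := f'A x xA; rewrite fz => /f_in - /(_ zA).
    by rewrite -fz -f'r => /f'_inj/eqP; rewrite (negPf xr).
  - by move=> /g_in[/eqP|[]]; rewrite ?(negPf xr) ?xA.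
  - rewrite f'C // => /WP[i]; rewrite leq_eqVlt => /orP[/eqP-> fx|lt_im fx].
      by rewrite (f_inj _ _ (etrans fx ym)) aA in xA.
    by rewrite -pE fx -yS yW.
  - by move=> /g_in[/eqP|[_]]; rewrite ?(negPf xr) // f'C.
pose D := [set x | g x \in W].
have clD : mates_closed f' g D by move=> x z f'g; rewrite !inE -fg f'g.
have rD : r \in D by rewrite inE.
move=> x xA /(subsetP (component_min clD rD)); rewrite inE.
by move=> /g_in[// | []]; rewrite xA.
Qed.

Lemma eq_component (T S : finType) (f g f' g' : T -> S) :
  f =1 f' -> g =1 g' -> component f g =1 component f' g'.
Proof.
move=> eq_f eq_g x; apply/setP=> y; rewrite !inE; apply: eq_connect => u v.
by rewrite /mates /= !eq_f !eq_g.
Qed.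

Lemma eq_mates_closed (T S : finType) (f g f' g' : T -> S) D :
  f =1 f' -> g =1 g' -> mates_closed f g D -> mates_closed f' g' D.
Proof. by move=> eq_f eq_g clD x y; rewrite -eq_f -eq_g; apply: clD. Qed.

(** * Exchanging two lines of a Latin rectangle *)

(** The width [p] is independent of the number [n] of symbols, so that the notion is stable under
    transposition and row moves reduce to column moves. *)
Definition latin m p n (L : 'M['I_n]_(m, p)) : Prop :=
  (forall i, injective (L i)) /\ (forall j, injective (L^~ j)).

Lemma latin_rectangleP k n (L : 'M['I_n]_(k, n)) :
  reflect (latin L) (latin_rectangle L).
Proof.
apply: (iffP andP) => -[/= rowL colL]; split.
- move=> i j j' eqL; have /forallP/(_ (L i j)) := forallP rowL i.
  by move/card_le1_eqP; apply; rewrite inE ?eqL.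
- move=> j i i' /= eqL; have /forallP/(_ (L i j)) := forallP colL j.
  by move/card_le1_eqP; apply; rewrite inE ?eqL.
- apply/forallP=> i; apply/forallP=> s; apply/card_le1_eqP=> j j'.
  by rewrite !inE => /eqP<- /eqP/rowL.
- apply/forallP=> j; apply/forallP=> s; apply/card_le1_eqP=> i i'.
  by rewrite !inE => /eqP<- /eqP/colL.
Qed.

Lemma latin_tr m p n (L : 'M['I_n]_(m, p)) : latin L -> latin L^T.
Proof.
case=> rowL colL; split=> [i j j' | j i i'] /=; rewrite !mxE; first exact: colL.
exact: rowL.
Qed.

(** Written with a transposition of column indices, this is an involution for every [D]; closedness
    of [D] matters only for staying Latin. *)
Definition swap_cols m p n (L : 'M['I_n]_(m, p)) c c' (D : {set 'I_m}) :=
  \matrix_(i, j) L i (if i \in D then tperm c c' j else j).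

Definition swap_rows m p n (L : 'M['I_n]_(m, p)) r r' (D : {set 'I_p}) :=
  \matrix_(i, j) L (if j \in D then tperm r r' i else i) j.

Section Swaps.
Variables (m p n : nat) (L : 'M['I_n]_(m, p)).

Lemma swap_cols_l c c' (D : {set 'I_m}) i : i \in D -> swap_cols L c c' D i c = L i c'.
Proof. by move=> iD; rewrite mxE iD tpermL. Qed.

Lemma swap_cols_r c c' (D : {set 'I_m}) i : i \in D -> swap_cols L c c' D i c' = L i c.
Proof. by move=> iD; rewrite mxE iD tpermR. Qed.

Lemma swap_cols_out c c' (D : {set 'I_m}) i j :
  i \notin D -> swap_cols L c c' D i j = L i j.
Proof. by move=> iD; rewrite mxE (negPf iD). Qed.

Lemma swap_cols_other c c' (D : {set 'I_m}) i j :
  c != j -> c' != j -> swap_cols L c c' D i j = L i j.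
Proof. by move=> cj c'j; rewrite mxE tpermD // if_same. Qed.

Lemma swap_colsK c c' (D : {set 'I_m}) : swap_cols (swap_cols L c c' D) c c' D = L.
Proof. by apply/matrixP=> i j; rewrite !mxE; case: (i \in D); rewrite ?tpermK. Qed.

Lemma swap_cols_exchange_l c c' (D : {set 'I_m}) :
  (swap_cols L c c' D)^~ c =1 exchange (L^~ c) (L^~ c') D.
Proof.
by move=> i; rewrite /exchange mxE; case: (i \in D); rewrite ?tpermL.
Qed.

Lemma swap_cols_exchange_r c c' (D : {set 'I_m}) :
  (swap_cols L c c' D)^~ c' =1 exchange (L^~ c') (L^~ c) D.
Proof.
by move=> i; rewrite /exchange mxE; case: (i \in D); rewrite ?tpermR.
Qed.

Lemma swap_rowsE r r' (D : {set 'I_p}) : swap_rows L r r' D = (swap_cols L^T r r' D)^T.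
Proof. by apply/matrixP=> i j; rewrite !mxE. Qed.

Lemma swap_rows_l r r' (D : {set 'I_p}) j : j \in D -> swap_rows L r r' D r j = L r' j.
Proof. by move=> jD; rewrite mxE jD tpermL. Qed.

Lemma swap_rows_r r r' (D : {set 'I_p}) j : j \in D -> swap_rows L r r' D r' j = L r j.
Proof. by move=> jD; rewrite mxE jD tpermR. Qed.

Lemma swap_rows_out r r' (D : {set 'I_p}) i j :
  j \notin D -> swap_rows L r r' D i j = L i j.
Proof. by move=> jD; rewrite mxE (negPf jD). Qed.

Lemma swap_rows_other r r' (D : {set 'I_p}) i j :
  r != i -> r' != i -> swap_rows L r r' D i j = L i j.
Proof. by move=> ri r'i; rewrite mxE tpermD // if_same. Qed.

Lemma swap_rowsK r r' (D : {set 'I_p}) : swap_rows (swap_rows L r r' D) r r' D = L.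
Proof. by apply/matrixP=> i j; rewrite !mxE; case: (j \in D); rewrite ?tpermK. Qed.

Hypothesis latL : latin L.

Lemma latin_swap_cols c c' (D : {set 'I_m}) :
  mates_closed (L^~ c) (L^~ c') D -> latin (swap_cols L c c' D).
Proof.
have [rowL colL] := latL => clD; split=> [i j j' | j].
  by rewrite !mxE => /rowL; case: (i \in D) => // /perm_inj.
have [<- | cj] := eqVneq c j.
  by apply: eq_inj (fsym (swap_cols_exchange_l c c' D)); apply: exchange_inj.
have [<- | c'j] := eqVneq c' j.
  apply: eq_inj (fsym (swap_cols_exchange_r c c' D)).
  by apply: exchange_inj => //; apply: mates_closedC.
by move=> i i' /=; rewrite !swap_cols_other // => /colL.
Qed.

Lemma component_swap_cols c c' (D : {set 'I_m}) :
    mates_closed (L^~ c) (L^~ c') D ->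
  component ((swap_cols L c c' D)^~ c) ((swap_cols L c c' D)^~ c')
    =1 component (L^~ c) (L^~ c').
Proof.
have [_ colL] := latL => clD x; rewrite -(component_exchange _ _ clD) //.
by apply: eq_component; [exact: swap_cols_exchange_l | exact: swap_cols_exchange_r].
Qed.

End Swaps.

Lemma swap_cols_inj m p n c c' (D : {set 'I_m}) :
  injective (fun L : 'M['I_n]_(m, p) => swap_cols L c c' D).
Proof. exact: inv_inj (fun L => swap_colsK L _ _ D). Qed.

Lemma swap_rows_inj m p n r r' (D : {set 'I_p}) :
  injective (fun L : 'M['I_n]_(m, p) => swap_rows L r r' D).
Proof. exact: inv_inj (fun L => swap_rowsK L _ _ D). Qed.

Section SwapRows.
Variables (m p n : nat) (L : 'M['I_n]_(m, p)).
Hypothesis latL : latin L.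

Lemma latin_swap_rows r r' (D : {set 'I_p}) :
  mates_closed (L r) (L r') D -> latin (swap_rows L r r' D).
Proof.
move=> clD; rewrite swap_rowsE; apply/latin_tr/latin_swap_cols; first exact: latin_tr.
by apply: eq_mates_closed clD => j; rewrite mxE.
Qed.

Lemma component_swap_rows r r' (D : {set 'I_p}) :
    mates_closed (L r) (L r') D ->
  component (swap_rows L r r' D r) (swap_rows L r r' D r') =1 component (L r) (L r').
Proof.
move=> clD x; have trE s : L s =1 L^T^~ s by move=> j; rewrite mxE.
rewrite [RHS](eq_component (trE r) (trE r')) -(component_swap_cols _ (D := D)).
- by apply: eq_component => j; rewrite swap_rowsE mxE.
- exact: latin_tr.
exact: eq_mates_closed clD.
Qed.

End SwapRows.

(** * Double counting *)

(* Rows r1, r2 of L restricted to columns c1, c2, c3 read  x y z / y z x. *)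
Definition cycle3 k n (L : 'M['I_n]_(k, n)) r1 r2 c1 c2 c3 :=
  [&& r1 != r2, L r2 c1 == L r1 c2, L r2 c2 == L r1 c3 & L r2 c3 == L r1 c1].

(* The third row reads  z x _ , so only the cell (r3, c3) may be wrong. *)
Definition near_subsquare3 k n (L : 'M['I_n]_(k, n)) r1 r2 r3 c1 c2 c3 :=
  [&& cycle3 L r1 r2 c1 c2 c3, L r3 c1 == L r1 c3 & L r3 c2 == L r1 c1].

Definition subsquare3 k n (L : 'M['I_n]_(k, n)) r1 r2 r3 c1 c2 c3 :=
  near_subsquare3 L r1 r2 r3 c1 c2 c3 && (L r3 c3 == L r1 c2).

Definition rectangles k n : {set 'M['I_n]_(k, n)} := [set L | latin_rectangle L].

Definition cycles k n : {set 'M['I_n]_(k, n) * ('I_k * 'I_k) * ('I_n * 'I_n * 'I_n)} :=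
  [set t | let: (L, (r1, r2), (c1, c2, c3)) := t in
           latin_rectangle L && cycle3 L r1 r2 c1 c2 c3].

Definition near_subsquares k n :
    {set 'M['I_n]_(k, n) * ('I_k * 'I_k * 'I_k) * ('I_n * 'I_n * 'I_n)} :=
  [set t | let: (L, (r1, r2, r3), (c1, c2, c3)) := t in
           latin_rectangle L && near_subsquare3 L r1 r2 r3 c1 c2 c3].

Definition subsquares k n :
    {set 'M['I_n]_(k, n) * ('I_k * 'I_k * 'I_k) * ('I_n * 'I_n * 'I_n)} :=
  [set t | let: (L, (r1, r2, r3), (c1, c2, c3)) := t in
           latin_rectangle L && subsquare3 L r1 r2 r3 c1 c2 c3].

Lemma cycle3_uniq k n (L : 'M['I_n]_(k, n)) r1 r2 c1 c2 c3 :
  latin L -> cycle3 L r1 r2 c1 c2 c3 -> [/\ c1 != c2, c1 != c3 & c2 != c3].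
Proof.
move=> [rowL colL] /and4P[r12 /eqP e1 /eqP e2 /eqP e3]; split.
- by apply: contra_neq r12 => c12; apply/esym/(colL c1); rewrite /= e1 c12.
- by apply: contra_neq r12 => c13; apply/esym/(colL c3); rewrite /= e3 c13.
- by apply: contra_neq r12 => c23; apply/esym/(colL c2); rewrite /= e2 c23.
Qed.

Lemma near_subsquare3_uniq k n (L : 'M['I_n]_(k, n)) r1 r2 r3 c1 c2 c3 :
    latin L -> near_subsquare3 L r1 r2 r3 c1 c2 c3 ->
  [/\ r1 != r2, r1 != r3 & r2 != r3].
Proof.
move=> latL /and3P[cyc /eqP e1 /eqP e2]; have [rowL colL] := latL.
have [c12 c13 c23] := cycle3_uniq latL cyc.
have /and4P[r12 /eqP e3 /eqP e4 /eqP e5] := cyc; split=> //.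
  by apply: contra_neq c13 => r13; apply: (rowL r1); rewrite -e1 r13.
by apply: contra_neq c13 => r23; apply: (rowL r1); rewrite -e2 -e4 r23.
Qed.

(** Both rows carry the same three symbols on these columns, so exchanging the rows there keeps the
    rectangle Latin. *)
Lemma cycle3_mates_closed k n (L : 'M['I_n]_(k, n)) r1 r2 c1 c2 c3 :
  latin L -> cycle3 L r1 r2 c1 c2 c3 -> mates_closed (L r1) (L r2) [set c1; c2; c3].
Proof.
move=> [rowL _] /and4P[_ /eqP e1 /eqP e2 /eqP e3].
apply: mates_closed_imset => // x; rewrite !inE -orbA => /or3P[]/eqP->.
- by exists c3; rewrite // !inE eqxx !orbT.
- by exists c1; rewrite // !inE eqxx.
- by exists c2; rewrite // !inE eqxx orbT.
Qed.

Lemma card_setC3 (T : finType) (x y z : T) :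
  x != y -> x != z -> y != z -> #|~: [set x; y; z]| = (#|T| - 3)%N.
Proof.
move=> xy xz yz.
by rewrite cardsCs setCK -setUA cardsU1 cards2 !inE negb_or xy xz yz.
Qed.

(* Exchanging columns c3 and c on the component of r1 merges the 3-cycle into a
   longer cycle, in which c3, c1, c2, c are consecutive and hence determined by
   c3.  Exchanging the rows r1, r2 on the 3-cycle unblocks the move. *)
Lemma card_cycles_le k n :
  (#|cycles k n| * (n - 3) <= 2 * (#|rectangles k n| * (k * k.-1) * n))%N.
Proof.
pose X : {set 'M['I_n]_(k, n) * ('I_k * 'I_k) * ('I_n * 'I_n * 'I_n) * 'I_n} :=
  [set t | let: (L, (r1, r2), (c1, c2, c3), c) := t in
    (latin_rectangle L && cycle3 L r1 r2 c1 c2 c3) && (c \in ~: [set c1; c2; c3])].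
have -> : (#|cycles k n| * (n - 3) = #|X|)%N.
  pose Q (t : 'M['I_n]_(k, n) * ('I_k * 'I_k) * ('I_n * 'I_n * 'I_n)) :=
    ~: [set t.2.1.1; t.2.1.2; t.2.2].
  rewrite -(card_dep_pairs (Q := Q)).
    by apply: eq_card => -[[[L [r1 r2]] [[c1 c2] c3]] c]; rewrite !inE.
  move=> [[L [r1 r2]] [[c1 c2] c3]]; rewrite inE => /andP[/latin_rectangleP latL].
  by move=> /(cycle3_uniq latL)[c12 c13 c23]; rewrite card_setC3 // card_ord.
pose P := [set t in X | let: (L, (r1, r2), (c1, c2, c3), c) := t in
  r2 \notin component (L^~ c3) (L^~ c) r1].
have XP : (#|X| <= #|{: bool}| * #|P|)%N.
  (* Swapping the labels along with the rows makes the tuple read x y z / y z x again. *)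
  pose phi (b : bool) (t : 'M['I_n]_(k, n) * ('I_k * 'I_k) * ('I_n * 'I_n * 'I_n) * 'I_n) :=
    let: (L, (r1, r2), (c1, c2, c3), c) := t in
    if b then (swap_rows L r1 r2 [set c1; c2; c3], (r2, r1), (c1, c2, c3), c) else t.
  apply: (leq_card_cover (phi := phi)).
    case=> -[[[L [r1 r2]] [[c1 c2] c3]] c] [[[L' [r1' r2']] [[c1' c2'] c3']] c'] //= _ _.
    by case=> E ? ? ? ? ? ?; subst; rewrite (swap_rows_inj E).
  move=> [[[L [r1 r2]] [[c1 c2] c3]] c] Xt; have := Xt.
  rewrite inE => /andP[/andP[/latin_rectangleP latL cyc] Cc].
  have [c12 c13 c23] := cycle3_uniq latL cyc.
  have /and4P[r12 /eqP e1 /eqP e2 /eqP e3] := cyc.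
  have [rowL colL] := latL.
  have r1A : r1 \in [set r1; r2] by rewrite !inE eqxx.
  (* Row [r1] must receive the symbol [L a c3] in column [c3]: [L] itself does this if [a = r1], and
     the rearranged [M] does if [a = r2]. *)
  have [a + isol] := isolating_value (colL c3) (colL c) r1A.
  rewrite !inE => /orP[]/eqP Ea.
    exists false; rewrite /= inE Xt /=; apply: contra_neqN r12 => r2comp.
    apply/esym/(isol (L^~ c3)) => //; first by rewrite Ea.
      by move=> x xA; apply: imset_f.
    by rewrite !inE eqxx orbT.
  exists true; rewrite /phi /=; set C := [set c1; c2; c3]; set M := swap_rows L r1 r2 C.
  have latM : latin M by apply/latin_swap_rows/cycle3_mates_closed.
  have C1 : c1 \in C by rewrite !inE eqxx.
  have C2 : c2 \in C by rewrite !inE eqxx orbT.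
  have C3 : c3 \in C by rewrite !inE eqxx !orbT.
  rewrite inE; apply/andP; split.
    rewrite inE Cc andbT; apply/andP; split; first exact/latin_rectangleP.
    by rewrite /cycle3 eq_sym r12 !swap_rows_l // !swap_rows_r // e1 e2 e3 !eqxx.
  rewrite component_sym; apply: contra_neqN r12 => r2comp.
  have Mc : M^~ c =1 L^~ c.
    by move=> i; rewrite /= swap_rows_out //; rewrite inE in Cc.
  apply/esym/(isol (M^~ c3)).
  - by case: latM.
  - by rewrite /= swap_rows_l // Ea.
  - by move=> i; rewrite !inE negb_or => /andP[i1 i2]; rewrite swap_rows_other // eq_sym.
  - move=> i; rewrite !inE => /orP[]/eqP->; apply/imsetP.
      by exists r2; rewrite ?swap_rows_l // !inE eqxx orbT.
    by exists r1; rewrite ?swap_rows_r // !inE eqxx.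
  - by rewrite !inE eqxx orbT.
  - by rewrite -(eq_component (frefl _) Mc).
rewrite card_bool in XP; apply: (leq_trans XP); rewrite leq_pmul2l //.
pose F (t : 'M['I_n]_(k, n) * ('I_k * 'I_k) * ('I_n * 'I_n * 'I_n) * 'I_n) :=
  let: (L, (r1, r2), (c1, c2, c3), c) := t in
  (swap_cols L c3 c (component (L^~ c3) (L^~ c) r1), (r1, r2), c3).
pose B : {set 'M['I_n]_(k, n) * ('I_k * 'I_k) * 'I_n} :=
  setX (setX (rectangles k n)
             [set r | (r.1 \in [set: 'I_k]) && (r.2 \in ~: [set r.1])]) setT.
have -> : (#|rectangles k n| * (k * k.-1) * n = #|B|)%N.
  rewrite !cardsX cardsT card_ord.
  rewrite (card_dep_pairs (Q := fun r => ~: [set r]) (m := k.-1)) ?cardsT ?card_ord //.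
  by move=> r _; rewrite cardsCs setCK cards1 card_ord subn1.
(* Row [r2] has not moved. Its symbols in columns [c3], [c1], [c2] of [M], looked up in row [r1],
   give [c1], [c2], [c] in turn. *)
have rec L r1 r2 c1 c2 c3 c : (L, (r1, r2), (c1, c2, c3), c) \in P ->
    let M := swap_cols L c3 c (component (L^~ c3) (L^~ c) r1) in
  [/\ latin M, r1 != r2, M r1 c1 = M r2 c3 & M r1 c2 = M r2 c1] /\
  (M r1 c = M r2 c2 /\ L = swap_cols M c3 c (component (M^~ c3) (M^~ c) r1)).
  rewrite inE inE => /andP[/andP[/andP[/latin_rectangleP latL cyc] Cc] r2N].
  have [c12 c13 c23] := cycle3_uniq latL cyc.
  have /and4P[r12 /eqP e1 /eqP e2 /eqP e3] := cyc.
  have [rowL colL] := latL; move: Cc; rewrite !inE !negb_or => /andP[/andP[Cc1 Cc2] Cc3].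
  have cl := @component_closed _ _ (L^~ c3) (L^~ c) r1.
  move=> M; rewrite (component_swap_cols latL cl) swap_colsK.
  split; [split | split] => //; first exact: latin_swap_cols.
  - by rewrite [RHS]swap_cols_out // e3 swap_cols_other // eq_sym.
  - by rewrite [RHS]swap_cols_out // e1 swap_cols_other // eq_sym.
  - by rewrite [RHS]swap_cols_out // e2 swap_cols_r // component_refl.
apply: (leq_card_inj_in (F := F)).
  move=> [[[L [r1 r2]] [[c1 c2] c3]] c] /rec[[latM r12 _ _] _].
  by rewrite !inE /= eq_sym r12 !andbT; apply/latin_rectangleP.
move=> [[[L [r1 r2]] [[c1 c2] c3]] c] [[[L' [r1' r2']] [[c1' c2'] c3']] c'] /rec + /rec.
rewrite /F; set M := swap_cols L c3 c _; set M' := swap_cols L' c3' c' _.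
move=> [[[rowM _] _ m1 m2] [m3 ->]] [[_ _ m1' m2'] [m3' ->]] [EM E1 E2 E3].
move: m1' m2' m3'; rewrite -EM -E1 -E2 -E3 -m1 => /rowM -> ; rewrite -m2 => /rowM->.
by rewrite -m3 => /rowM->.
Qed.

(** Columns [c1] and [c2] avoid the doubtful cell; they read x y z and y z x down the three rows. *)
Lemma near_subsquare3_mates_closed k n (L : 'M['I_n]_(k, n)) r1 r2 r3 c1 c2 c3 :
    latin L -> near_subsquare3 L r1 r2 r3 c1 c2 c3 ->
  mates_closed (L^~ c1) (L^~ c2) [set r1; r2; r3].
Proof.
move=> [_ colL] /and3P[/and4P[_ /eqP e1 /eqP e2 /eqP e3] /eqP e4 /eqP e5].
apply: mates_closed_imset => // x; rewrite !inE -orbA => /or3P[]/eqP->.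
- by exists r3; rewrite // !inE eqxx !orbT.
- by exists r1; rewrite // !inE eqxx.
- by exists r2; rewrite ?e4 // !inE eqxx orbT.
Qed.

(* Exchanging rows r3 and r on the component of c1 leaves a 3-cycle in r1, r2
   whose completing symbols in columns c1 and c2 lie in the distinct rows r and
   r3.  Forgetting r3 instead gives 3-cycles for which these rows coincide; as
   the two images are disjoint, k - 3 improves to k - 1. *)
Lemma card_near_subsquares_le k n :
  (#|near_subsquares k n| * k.-1 <= 2 * #|cycles k n|)%N.
Proof.
have [-> | k_gt0] := posnP k; first by rewrite muln0.
pose X : {set 'M['I_n]_(k, n) * ('I_k * 'I_k * 'I_k) * ('I_n * 'I_n * 'I_n) * 'I_k} :=
  [set t | let: (L, (r1, r2, r3), (c1, c2, c3), r) := t in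
    (latin_rectangle L && near_subsquare3 L r1 r2 r3 c1 c2 c3)
      && (r \in ~: [set r1; r2; r3])].
have cardX : (#|near_subsquares k n| * (k - 3) = #|X|)%N.
  pose Q (t : 'M['I_n]_(k, n) * ('I_k * 'I_k * 'I_k) * ('I_n * 'I_n * 'I_n)) :=
    ~: [set t.1.2.1.1; t.1.2.1.2; t.1.2.2].
  rewrite -(card_dep_pairs (Q := Q)).
    by apply: eq_card => -[[[L [[r1 r2] r3]] [[c1 c2] c3]] r]; rewrite !inE.
  move=> [[L [[r1 r2] r3]] [[c1 c2] c3]].
  rewrite inE => /andP[/latin_rectangleP latL].
  by move=> /(near_subsquare3_uniq latL)[r12 r13 r23]; rewrite card_setC3 // card_ord.
pose P := [set t in X | let: (L, (r1, r2, r3), (c1, c2, c3), r) := t in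
  c2 \notin component (L r3) (L r) c1].
have XP : (#|X| <= 2 * #|P|)%N.
  pose phi (b : bool)
      (t : 'M['I_n]_(k, n) * ('I_k * 'I_k * 'I_k) * ('I_n * 'I_n * 'I_n) * 'I_k) :=
    let: (L, (r1, r2, r3), (c1, c2, c3), r) := t in
    if b then (swap_cols L c1 c2 [set r1; r2; r3], (r1, r2, r3), (c2, c1, c3), r) else t.
  rewrite -card_bool; apply: (leq_card_cover (phi := phi)).
    case=> -[[[L [[r1 r2] r3]] [[c1 c2] c3]] r].
      case=> [[[L' [[r1' r2'] r3']] [[c1' c2'] c3']] r'] _ _.
      by case=> E ? ? ? ? ? ? ?; subst; rewrite (swap_cols_inj E).
    by case=> [[[L' [[r1' r2'] r3']] [[c1' c2'] c3']] r'].
  move=> [[[L [[r1 r2] r3]] [[c1 c2] c3]] r] Xt; have := Xt.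
  rewrite inE => /andP[/andP[/latin_rectangleP latL near] Rr].
  have /and3P[cyc /eqP e4 /eqP e5] := near.
  have [c12 c13 c23] := cycle3_uniq latL cyc.
  have [r12 r13 r23] := near_subsquare3_uniq latL near.
  have /and4P[_ /eqP e1 /eqP e2 /eqP e3] := cyc.
  have [rowL colL] := latL.
  have c1A : c1 \in [set c1; c2] by rewrite !inE eqxx.
  have [a + isol] := isolating_value (rowL r3) (rowL r) c1A.
  rewrite !inE => /orP[]/eqP Ea.
    exists false; rewrite /= inE Xt /=; apply: contra_neqN c12 => c2comp.
    apply/esym/(isol (L r3)) => //; first by rewrite Ea.
      by move=> x xA; apply: imset_f.
    by rewrite !inE eqxx orbT.
  exists true; rewrite /phi /=; set D := [set r1; r2; r3]; set M := swap_cols L c1 c2 D.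
  have latM : latin M by apply: latin_swap_cols (near_subsquare3_mates_closed latL near).
  have D1 : r1 \in D by rewrite !inE eqxx.
  have D2 : r2 \in D by rewrite !inE eqxx orbT.
  have D3 : r3 \in D by rewrite !inE eqxx !orbT.
  rewrite inE; apply/andP; split.
    rewrite inE Rr andbT; apply/andP; split; first exact/latin_rectangleP.
    rewrite /near_subsquare3 /cycle3 r12 !swap_cols_l // !swap_cols_r //.
    by rewrite !swap_cols_other // e1 e2 e3 e4 e5 !eqxx.
  rewrite component_sym; apply: contra_neqN c12 => c2comp.
  have Mr : M r =1 L r by move=> j; rewrite swap_cols_out //; rewrite inE in Rr.
  apply/esym/(isol (M r3)).
  - by case: latM.
  - by rewrite swap_cols_l // Ea.
  - by move=> i; rewrite !inE negb_or => /andP[i1 i2]; rewrite swap_cols_other // eq_sym.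
  - move=> i; rewrite !inE => /orP[]/eqP->; apply/imsetP.
      by exists c2; rewrite ?swap_cols_l // !inE eqxx orbT.
    by exists c1; rewrite ?swap_cols_r // !inE eqxx.
  - by rewrite !inE eqxx orbT.
  - by rewrite -(eq_component (frefl _) Mr).
pose completed := [set t in cycles k n | let: (L, (r1, r2), (c1, c2, c3)) := t in
  [exists r, (L r c1 == L r1 c3) && (L r c2 == L r1 c1)]].
have Ncomp : (#|near_subsquares k n| <= #|completed|)%N.
  pose F (t : 'M['I_n]_(k, n) * ('I_k * 'I_k * 'I_k) * ('I_n * 'I_n * 'I_n)) :=
    let: (L, (r1, r2, r3), (c1, c2, c3)) := t in (L, (r1, r2), (c1, c2, c3)).
  apply: (leq_card_inj_in (F := F)).
    move=> [[L [[r1 r2] r3]] [[c1 c2] c3]].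
    rewrite inE => /and4P[latL cyc e1 e2]; rewrite !inE /= latL cyc /=.
    by apply/existsP; exists r3; rewrite e1.
  move=> [[L [[r1 r2] r3]] [[c1 c2] c3]] [[L' [[r1' r2'] r3']] [[c1' c2'] c3']].
  rewrite !inE => /and4P[/latin_rectangleP[_ colL] _ /eqP e _] /and4P[_ _ /eqP e' _].
  by case=> ? ? ? ? ? ?; subst; rewrite (colL c1' r3 r3') //= e e'.
have Pcomp : (#|P| <= #|cycles k n :\: completed|)%N.
  pose F (t : 'M['I_n]_(k, n) * ('I_k * 'I_k * 'I_k) * ('I_n * 'I_n * 'I_n) * 'I_k) :=
    let: (L, (r1, r2, r3), (c1, c2, c3), r) := t in
    (swap_rows L r3 r (component (L r3) (L r) c1), (r1, r2), (c1, c2, c3)).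
  have rec L r1 r2 r3 c1 c2 c3 r : (L, (r1, r2, r3), (c1, c2, c3), r) \in P ->
      let M := swap_rows L r3 r (component (L r3) (L r) c1) in
    [/\ latin M, cycle3 M r1 r2 c1 c2 c3, M r c1 = M r1 c3, M r3 c2 = M r1 c1
      & r3 != r /\ L = swap_rows M r3 r (component (M r3) (M r) c1)].
    rewrite inE inE => /andP[/andP[/andP[/latin_rectangleP latL near] Rr] c2N].
    have /and3P[cyc /eqP e4 /eqP e5] := near.
    have [c12 c13 c23] := cycle3_uniq latL cyc.
    have [r12 r13 r23] := near_subsquare3_uniq latL near.
    move: Rr; rewrite !inE !negb_or => /andP[/andP[Rr1 Rr2] Rr3].
    have cl := @component_closed _ _ (L r3) (L r) c1.
    move=> M; have M1 : M r1 =1 L r1 by move=> j; rewrite swap_rows_other // eq_sym.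
    have M2 : M r2 =1 L r2 by move=> j; rewrite swap_rows_other // eq_sym.
    rewrite (component_swap_rows latL cl) swap_rowsK !M1.
    rewrite swap_rows_r ?component_refl // swap_rows_out // eq_sym Rr3.
    split=> //; first exact: latin_swap_rows.
    by rewrite /cycle3 !M1 !M2.
  apply: (leq_card_inj_in (F := F)).
    move=> [[[L [[r1 r2] r3]] [[c1 c2] c3]] r] /rec[latM cycM e1 e2 [rr3 _]].
    move/latin_rectangleP: (latM) => latM'.
    (* A row completing the cycle in [M] would be [r] by column [c1] and [r3] by column [c2]. *)
    rewrite !inE /= latM' cycM /= andbT; apply/existsP=> -[r' /andP[/eqP e1' /eqP e2']].
    have [_ colM] := latM; case/eqP: rr3; transitivity r'.
      by apply: (colM c2); rewrite /= e2 e2'.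
    by apply: (colM c1); rewrite /= e1 e1'.
  move=> [[[L [[r1 r2] r3]] [[c1 c2] c3]] r] [[[L' [[r1' r2'] r3']] [[c1' c2'] c3']] r'].
  move=> /rec + /rec; rewrite /F.
  set M := swap_rows L r3 r _; set M' := swap_rows L' r3' r' _.
  move=> [[_ colM] _ m1 m2 [_ ->]] [_ _ m1' m2' [_ ->]] [EM E1 E2 E3 E4 E5].
  move: m1' m2'; rewrite -EM -E1 -E2 -E3 -E4 -E5 -m1 -m2.
  by move=> /(colM c1)-> /(colM c2)->.
(* The product with [k - 3] is at most [2 * #|P|], and the two remaining copies of the near
   subsquares are charged to [completed], which is disjoint from the image of [P]. *)
have le_k : (k.-1 <= (k - 3) + 2)%N by lia.
apply: leq_trans (leq_mul (leqnn _) le_k) _.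
rewrite mulnDr cardX mulnC -(cardsID completed (cycles k n)).
have -> : cycles k n :&: completed = completed.
  by apply/setIidPr/subsetP=> t; rewrite inE => /andP[].
lia.
Qed.

(* Exchanging columns c3 and c on the component of r3 spoils the cell (r3, c3),
   and c is recovered as the column in which row r3 has the missing symbol. *)
Lemma card_subsquares_le k n :
  (#|subsquares k n| * (n - 3) <= 3 * #|near_subsquares k n|)%N.
Proof.
pose X : {set 'M['I_n]_(k, n) * ('I_k * 'I_k * 'I_k) * ('I_n * 'I_n * 'I_n) * 'I_n} :=
  [set t | let: (L, (r1, r2, r3), (c1, c2, c3), c) := t in
    (latin_rectangle L && subsquare3 L r1 r2 r3 c1 c2 c3)
      && (c \in ~: [set c1; c2; c3])].
have -> : (#|subsquares k n| * (n - 3) = #|X|)%N.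
  pose Q (t : 'M['I_n]_(k, n) * ('I_k * 'I_k * 'I_k) * ('I_n * 'I_n * 'I_n)) :=
    ~: [set t.2.1.1; t.2.1.2; t.2.2].
  rewrite -(card_dep_pairs (Q := Q)).
    by apply: eq_card => -[[[L [[r1 r2] r3]] [[c1 c2] c3]] c]; rewrite !inE.
  move=> [[L [[r1 r2] r3]] [[c1 c2] c3]].
  rewrite inE => /andP[/latin_rectangleP latL /andP[/and3P[]]].
  by move=> /(cycle3_uniq latL)[c12 c13 c23]; rewrite card_setC3 // card_ord.
pose P := [set t in X | let: (L, (r1, r2, r3), (c1, c2, c3), c) := t in
  (r1 \notin component (L^~ c3) (L^~ c) r3) && (r2 \notin component (L^~ c3) (L^~ c) r3)].
have XP : (#|X| <= 3 * #|P|)%N.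
  (* A transposition of two rows of the subsquare reverses its cyclic orientation; exchanging the
     labels [r1] and [r2] restores it. *)
  pose phi (o : option bool)
      (t : 'M['I_n]_(k, n) * ('I_k * 'I_k * 'I_k) * ('I_n * 'I_n * 'I_n) * 'I_n) :=
    let: (L, (r1, r2, r3), (c1, c2, c3), c) := t in
    if o is Some b then
      (swap_rows L (if b then r1 else r2) r3 [set c1; c2; c3],
       (r2, r1, r3), (c1, c2, c3), c)
    else t.
  have -> : 3%N = #|{: option bool}| by rewrite card_option card_bool.
  apply: (leq_card_cover (phi := phi)).
    case=> [b|] -[[[L [[r1 r2] r3]] [[c1 c2] c3]] c].
      case=> [[[L' [[r1' r2'] r3']] [[c1' c2'] c3']] c'] _ _.
      by case=> E ? ? ? ? ? ? ?; subst; rewrite (swap_rows_inj E).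
    by case=> [[[L' [[r1' r2'] r3']] [[c1' c2'] c3']] c'].
  move=> [[[L [[r1 r2] r3]] [[c1 c2] c3]] c] Xt; have := Xt.
  rewrite inE => /andP[/andP[/latin_rectangleP latL sub] Cc].
  have /andP[near /eqP e6] := sub; have /and3P[cyc /eqP e4 /eqP e5] := near.
  have [c12 c13 c23] := cycle3_uniq latL cyc.
  have [r12 r13 r23] := near_subsquare3_uniq latL near.
  have /and4P[_ /eqP e1 /eqP e2 /eqP e3] := cyc.
  have [rowL colL] := latL.
  pose A := [set r1; r2; r3].
  have A1 : r1 \in A by rewrite !inE eqxx.
  have A2 : r2 \in A by rewrite !inE eqxx orbT.
  have A3 : r3 \in A by rewrite !inE eqxx !orbT.
  set C := [set c1; c2; c3] in Cc *.
  have C1 : c1 \in C by rewrite !inE eqxx.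
  have C2 : c2 \in C by rewrite !inE eqxx orbT.
  have C3 : c3 \in C by rewrite !inE eqxx !orbT.
  have cl13 : mates_closed (L r1) (L r3) C.
    rewrite /C -setUA [_ |: [set c3]]setUC setUA; apply: cycle3_mates_closed => //.
    by rewrite /cycle3 r13 e4 e5 e6 !eqxx.
  have cl23 : mates_closed (L r2) (L r3) C.
    by apply: cycle3_mates_closed; rewrite // /cycle3 r23 e1 e2 e3 e4 e5 e6 !eqxx.
  have [a Aa isol] := isolating_value (colL c3) (colL c) A3.
  have outC i r r' : swap_rows L r r' C i c = L i c.
    by rewrite swap_rows_out //; rewrite inE in Cc.
  suff turn b : (a = if b then r1 else r2) ->
      phi (Some b) (L, (r1, r2, r3), (c1, c2, c3), c) \in P.
    move: Aa; rewrite !inE -orbA => /or3P[]/eqP Ea.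
    - by exists (Some true); apply: turn.
    - by exists (Some false); apply: turn.
    exists None; rewrite /= inE Xt /=.
    have iso x : x \in A -> x != r3 -> x \notin component (L^~ c3) (L^~ c) r3.
      move=> xA; apply: contra_neqN => xcomp; apply: (isol (L^~ c3)) => //.
        by rewrite Ea.
      by move=> y yA; apply: imset_f.
    by rewrite !iso.
  move=> Ea; rewrite /phi -/C -Ea; set M := swap_rows L a r3 C.
  have clM : mates_closed (L a) (L r3) C by rewrite Ea; case: (b).
  have latM : latin M by apply: latin_swap_rows.
  have fA z : z \in A -> L z c3 \in (L^~ c3) @: A by move=> zA; apply: imset_f.
  have iso x : x \in A -> x != r3 -> x \notin component (M^~ c3) (M^~ c) r3.
    move=> xA; apply: contra_neqN => xcomp; apply: (isol (M^~ c3)) => //.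
    - by case: latM.
    - by rewrite /M swap_rows_r.
    - move=> y; rewrite inE => yA.
      by rewrite /M swap_rows_other //; apply: contraNneq yA => <-.
    - move=> y yA; have [<-|ya] := eqVneq a y; first by rewrite /M swap_rows_l //; apply: fA.
      have [<-|yr] := eqVneq r3 y; first by rewrite /M swap_rows_r //; apply: fA.
      by rewrite /M swap_rows_other //; apply: fA.
    by rewrite -(eq_component (frefl _) (fun i => outC i a r3)).
  rewrite inE !iso // !andbT inE Cc andbT.
  apply/andP; split; first exact/latin_rectangleP.
  have [r21 r31 r32] : [/\ r2 != r1, r3 != r1 & r3 != r2] by split; rewrite eq_sym.
  rewrite /M Ea /subsquare3 /near_subsquare3 /cycle3 r21.
  case: (b); rewrite !swap_rows_l // !swap_rows_r // !swap_rows_other //;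
    by rewrite e1 e2 e3 e4 e5 e6 !eqxx.
apply: (leq_trans XP); rewrite leq_pmul2l //.
pose F (t : 'M['I_n]_(k, n) * ('I_k * 'I_k * 'I_k) * ('I_n * 'I_n * 'I_n) * 'I_n) :=
  let: (L, (r1, r2, r3), (c1, c2, c3), c) := t in
  (swap_cols L c3 c (component (L^~ c3) (L^~ c) r3), (r1, r2, r3), (c1, c2, c3)).
have rec L r1 r2 r3 c1 c2 c3 c : (L, (r1, r2, r3), (c1, c2, c3), c) \in P ->
    let M := swap_cols L c3 c (component (L^~ c3) (L^~ c) r3) in
  [/\ latin M, near_subsquare3 M r1 r2 r3 c1 c2 c3, M r3 c = M r1 c2
    & L = swap_cols M c3 c (component (M^~ c3) (M^~ c) r3)].
  rewrite inE inE => /andP[/andP[/andP[/latin_rectangleP latL sub] Cc] /andP[r1N r2N]].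
  have /andP[near /eqP e6] := sub; have /and3P[cyc e4 e5] := near.
  have [c12 c13 c23] := cycle3_uniq latL cyc.
  move: Cc; rewrite !inE !negb_or => /andP[/andP[Cc1 Cc2] Cc3].
  have cl := @component_closed _ _ (L^~ c3) (L^~ c) r3.
  move=> M; have M1 j : M r1 j = L r1 j by rewrite swap_cols_out.
  have M2 j : M r2 j = L r2 j by rewrite swap_cols_out.
  have M3 j : c3 != j -> c != j -> M r3 j = L r3 j by move=> *; rewrite swap_cols_other.
  rewrite (component_swap_cols latL cl) swap_colsK !M1 swap_cols_r ?component_refl //.
  split=> //; first exact: latin_swap_cols.
  have [c31 c32] : c3 != c1 /\ c3 != c2 by split; rewrite eq_sym.
  by rewrite /near_subsquare3 /cycle3 !M1 !M2 !M3 // e4 e5 !andbT.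
apply: (leq_card_inj_in (F := F)).
  move=> [[[L [[r1 r2] r3]] [[c1 c2] c3]] c] /rec[latM near _ _].
  by rewrite inE /= near andbT; apply/latin_rectangleP.
move=> [[[L [[r1 r2] r3]] [[c1 c2] c3]] c] [[[L' [[r1' r2'] r3']] [[c1' c2'] c3']] c'].
move=> /rec + /rec; rewrite /F.
set M := swap_cols L c3 c _; set M' := swap_cols L' c3' c' _.
move=> [[rowM _] _ m ->] [_ _ m' ->] [EM E1 E2 E3 E4 E5 E6].
by move: m'; rewrite -EM -E1 -E2 -E3 -E4 -E5 -E6 -m => /rowM->.
Qed.

(** * From labelled subsquares to the expected number *)

(** In a Latin square of order 3, row [r2] is a cyclic shift of row [r1]; the direction of the shift
    fixes the order of the two remaining columns. *)
Lemma is_subsquare3_exists k n (L : 'M['I_n]_(k, n)) A B r1 r2 c1 :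
    latin L -> is_subsquare 3 L A B -> r1 \in A -> r2 \in A -> r1 != r2 -> c1 \in B ->
  exists r3 c2 c3, [/\ subsquare3 L r1 r2 r3 c1 c2 c3,
    A = [set r1; r2; r3] & B = [set c1; c2; c3]].
Proof.
move=> [rowL colL] /and3P[/eqP A3 /eqP B3 /eqP S3] r1A r2A r12 c1B.
have /cards1P[r3 Er3] : #|A :\ r1 :\ r2| == 1%N.
  move: (cardsD1 r1 A) (cardsD1 r2 (A :\ r1)).
  by rewrite A3 r1A !inE eq_sym r12 r2A; lia.
have /cards2P[c [d [cd Ecd]]] : #|B :\ c1| == 2%N.
  by move: (cardsD1 c1 B); rewrite B3 c1B; lia.
have EB : B = [set c1; c; d] by rewrite -setUA -Ecd setD1K.
have EA : A = [set r1; r2; r3].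
  rewrite -(setD1K r1A) -(setD1K (a := r2) (A := A :\ r1)) ?Er3 ?setUA //.
  by rewrite !inE eq_sym r12.
have [c1c c1d] : c1 != c /\ c1 != d.
  by split; apply/eqP=> E; have := setD11 c1 B; rewrite Ecd !inE E eqxx ?orbT.
have [r13 r23] : r1 != r3 /\ r2 != r3.
  have : r3 \in A :\ r1 :\ r2 by rewrite Er3 inE.
  by rewrite !inE => /and3P[r32 r31 _]; split; rewrite eq_sym.
have ES : [set L i j | i in A, j in B] = [set L r1 c1; L r1 c; L r1 d].
  apply/esym/eqP; rewrite eqEcard S3; apply/andP; split.
    apply/subsetP=> s; rewrite !inE -orbA => /or3P[]/eqP->; apply: imset2_f => //;
      by rewrite EB !inE eqxx ?orbT.
  by rewrite -setUA cardsU1 cards2 !inE negb_or !(inj_eq (rowL r1)) c1c c1d cd.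
have inS i j : i \in A -> j \in B ->
    [\/ L i j = L r1 c1, L i j = L r1 c | L i j = L r1 d].
  move=> iA jB; have : L i j \in [set L i j | i in A, j in B] by apply: imset2_f.
  by rewrite ES !inE -orbA => /or3P[]/eqP->; [constructor 1|constructor 2|constructor 3].
have [cB dB r3A] : [/\ c \in B, d \in B & r3 \in A].
  by rewrite EB EA !inE !eqxx !orbT.
have rowN i j j' : j != j' -> L i j <> L i j' by move=> jj' /rowL/eqP; apply/negP.
have colN i i' j : i != i' -> L i j <> L i' j by move=> ii' /(colL j)/eqP; apply/negP.
have dc : d != c by rewrite eq_sym.
(* With all distinctness facts in the goal, each wrong choice of symbols contradicts one of them.
   Only the two cyclic fillings survive, and the second takes the columns in the order [d], [c]. *)
have := colN _ _ c1 r12; have := colN _ _ c r12; have := colN _ _ d r12.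
have := colN _ _ c1 r13; have := colN _ _ c r13; have := colN _ _ d r13.
have := colN _ _ c1 r23; have := colN _ _ c r23; have := colN _ _ d r23.
have := rowN r2 _ _ c1c; have := rowN r2 _ _ c1d; have := rowN r2 _ _ cd.
have := rowN r3 _ _ c1c; have := rowN r3 _ _ c1d; have := rowN r3 _ _ cd.
case: (inS r2 c1 r2A c1B) => e1; rewrite ?e1 //;
case: (inS r2 c r2A cB) => e2; rewrite ?e2 //;
case: (inS r2 d r2A dB) => e3; rewrite ?e3 //;
case: (inS r3 c1 r3A c1B) => e4; rewrite ?e4 //;
case: (inS r3 c r3A cB) => e5; rewrite ?e5 //;
case: (inS r3 d r3A dB) => e6; rewrite ?e6 // => *.
- exists r3, c, d; split=> //.
  by rewrite /subsquare3 /near_subsquare3 /cycle3 r12 e1 e2 e3 e4 e5 e6 !eqxx.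
- exists r3, d, c; split; rewrite // ?EB.
    by rewrite /subsquare3 /near_subsquare3 /cycle3 r12 e1 e2 e3 e4 e5 e6 !eqxx.
  by rewrite -!setUA [[set c; d]]setUC.
Qed.

(* 18 = 3 * 2 * 3 labellings: r1, r2 and c1 determine r3, c2 and c3. *)
Lemma sum_subsquares_le k n :
  (18 * \sum_(L : 'M['I_n]_(k, n) | latin_rectangle L) num_subsquares 3 L
     <= #|subsquares k n|)%N.
Proof.
pose Y : {set 'M['I_n]_(k, n) * ({set 'I_k} * {set 'I_n})} :=
  [set t | (t.1 \in rectangles k n)
     && (t.2 \in [set AB | is_subsquare 3 t.1 AB.1 AB.2])].
have -> : (\sum_(L : 'M['I_n]_(k, n) | latin_rectangle L) num_subsquares 3 L = #|Y|)%N.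
  rewrite -sum1dep_card -(pair_big_dep (mem (rectangles k n))
    (fun L AB => AB \in [set AB | is_subsquare 3 L AB.1 AB.2]) (fun _ _ => 1%N)) /=.
  by apply: eq_big => [L | L _]; rewrite ?inE // sum1_card.
pose Q (t : 'M['I_n]_(k, n) * ({set 'I_k} * {set 'I_n})) :=
  setX [set r | (r.1 \in t.2.1) && (r.2 \in t.2.1 :\ r.1)] t.2.2.
have cardQ : {in Y, forall t, #|Q t| = 18}.
  move=> [L [A B]]; rewrite !inE /= => /andP[_ /and3P[/eqP A3 /eqP B3 _]].
  rewrite cardsX B3 (card_dep_pairs (Q := fun r => A :\ r) (m := 2)) ?A3 //.
  by move=> r rA; move: (cardsD1 r A); rewrite rA A3; lia.
rewrite mulnC -(card_dep_pairs cardQ).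
(* [h] keeps the underlying sets and the three free labels; its image contains every such choice,
   which bounds their number. *)
pose h (t : 'M['I_n]_(k, n) * ('I_k * 'I_k * 'I_k) * ('I_n * 'I_n * 'I_n)) :=
  let: (L, (r1, r2, r3), (c1, c2, c3)) := t in
  (L, ([set r1; r2; r3], [set c1; c2; c3]), (r1, r2, c1)).
apply: leq_trans (leq_imset_card h _).
apply/subset_leq_card/subsetP=> -[[L [A B]] [[r1 r2] c1]].
rewrite !inE /= => /andP[/andP[latL sub] /andP[/and3P[r1A r21 r2A] c1B]].
have r12 : r1 != r2 by rewrite eq_sym.
have /latin_rectangleP latL' := latL.
have [r3 [c2 [c3 [sub3 -> ->]]]] := is_subsquare3_exists latL' sub r1A r2A r12 c1B.
by apply/imsetP; exists (L, (r1, r2, r3), (c1, c2, c3)); rewrite // inE latL.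
Qed.

(** The counting inequalities are chained after multiplication by [6 * k.-1]; this factor is
    positive and cancels. *)
Lemma sum_num_subsquares3_le k n : (1 < k)%N ->
  (3 * (n - 3) ^ 2 * \sum_(L : 'M['I_n]_(k, n) | latin_rectangle L) num_subsquares 3 L
     <= 2 * k * n * #|rectangles k n|)%N.
Proof.
move=> k_gt1.
have := sum_subsquares_le k n; have := card_subsquares_le k n.
have := card_near_subsquares_le k n; have := card_cycles_le k n.
set s := (\sum_(L | _) _)%N.
move: #|subsquares k n| #|near_subsquares k n| #|cycles k n| #|rectangles k n| => S N T R.
set m := (n - 3)%N => TR NT SN sS.
have k1 : (0 < k.-1)%N by lia.
rewrite -(leq_pmul2r k1) -(@leq_pmul2l 6) //.
have h1 : (18 * s * m * m * k.-1 <= S * m * m * k.-1)%N by rewrite !leq_mul2r sS !orbT.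
have h2 : (S * m * m * k.-1 <= 3 * N * m * k.-1)%N by rewrite !leq_mul2r SN !orbT.
have h3 : (3 * (N * k.-1) * m <= 3 * (2 * T) * m)%N by rewrite leq_mul2r leq_mul2l NT !orbT.
have h4 : (6 * (T * m) <= 6 * (2 * (R * (k * k.-1) * n)))%N by rewrite leq_mul2l TR.
have -> : (6 * (3 * m ^ 2 * s * k.-1) = 18 * s * m * m * k.-1)%N by rewrite expnS expn1; lia.
lia.
Qed.

Lemma expected_subsquares3_le (R : realFieldType) k n : (3 <= k <= n)%N -> (4 <= n)%N ->
  expected_subsquares R 3 k n
    <= 2%:R * k%:R / (3%:R * n%:R) * (1 + (6 * n - 9)%:R / ((n - 3) ^ 2)%:R).
Proof.
move=> /andP[k3 kn] n4; have := @sum_num_subsquares3_le k n (leq_trans (isT : 1 < 3)%N k3).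
rewrite /expected_subsquares -natr_sum -/(rectangles k n).
move: (\sum_(L | _) _)%N #|rectangles k n|; set m := (n - 3)%N => s r le_sr.
have m_gt0 : 0 < m%:R :> R by rewrite ltr0n /m; lia.
have n_gt0 : 0 < n%:R :> R by rewrite ltr0n; lia.
(* The two factors [n - 3] of the count give the correction [(n / (n - 3)) ^ 2]. *)
have -> : 1 + (6 * n - 9)%:R / (m ^ 2)%:R = (n%:R / m%:R) ^+ 2 :> R.
  have e : n%:R ^+ 2 = m%:R ^+ 2 + (6 * n - 9)%:R :> R.
    by rewrite -!natrX -natrD; congr _%:R; rewrite /m; nia.
  by rewrite natrX expr_div_n e; field; rewrite lt0r_neq0.
(* For [r = 0] the quotient is 0 by the convention on division by zero. *)
have [-> | r_gt0] := posnP r.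
  by rewrite mulr0n invr0 mulr0 mulr_ge0 ?sqr_ge0 ?divr_ge0 // ?mulr_ge0 // ler0n.
have r0 : 0 < r%:R :> R by rewrite ltr0n.
rewrite ler_pdivrMr //.
have -> : 2 * k%:R / (3 * n%:R) * (n%:R / m%:R) ^+ 2 * r%:R
    = (2 * k * n * r)%:R / (3 * m ^ 2)%:R :> R.
  by rewrite [(3 * _)%:R]natrM natrX !natrM; field; rewrite !lt0r_neq0.
have m3_gt0 : (0 < 3 * m ^ 2)%N by rewrite muln_gt0 expn_gt0 /m subn_gt0 n4.
by rewrite ler_pdivlMr ?ltr0n // -natrM ler_nat mulnC.
Qed.

Theorem theorem4p1 (R : realFieldType) :
  exists eps : nat -> nat -> R,
    (exists (C : R) (N : nat), forall k n : nat,
        (N <= n)%N -> (3 <= k <= n)%N -> `|eps k n| <= C / k%:R) /\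
    (forall k n : nat, (3 <= k <= n)%N ->
        expected_subsquares R 3 k n
          <= 2%:R * k%:R / (3%:R * n%:R) * (1 + eps k n)).
Proof.
pose main k n : R := 2%:R * k%:R / (3%:R * n%:R).
have main_gt0 k n : (3 <= k <= n)%N -> 0 < main k n.
  by move=> kn; rewrite divr_gt0 ?mulr_gt0 ?ltr0n //; lia.
(* The least nonnegative error for which the bound holds; it also covers [n = 3], where the explicit
   correction has denominator 0. *)
exists (fun k n => Num.max 0 (expected_subsquares R 3 k n / main k n - 1)).
split=> [|k n kn]; last first.
  rewrite -/(main k n) -ler_pdivrMl ?main_gt0 // mulrC -lerBlDl.
  by rewrite le_max lexx orbT.
(* The error is of order [1 / n], hence of order [1 / k] as [k <= n]. The constants come from
   [n * (6 * n - 9) <= 24 * (n - 3) ^ 2], that is [2 * n ^ 2 + 24 >= 15 * n], which holds from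
   [n = 6] on. *)
exists 24, 6 => k n n6 kn; have [k3 le_kn] := andP kn.
have k_gt0 : 0 < k%:R :> R by rewrite ltr0n; lia.
have n_gt0 : 0 < n%:R :> R by rewrite ltr0n; lia.
have n3_gt0 : 0 < ((n - 3) ^ 2)%:R :> R by rewrite ltr0n expn_gt0; lia.
rewrite ger0_norm ?le_max ?lexx // ge_max divr_ge0 ?ler0n //=.
apply: (@le_trans _ _ ((6 * n - 9)%:R / ((n - 3) ^ 2)%:R)).
  rewrite lerBlDl ler_pdivrMr ?main_gt0 // mulrC.
  by apply: expected_subsquares3_le => //; lia.
rewrite ler_pdivrMr // mulrAC ler_pdivlMr // -!natrM ler_nat.
have : (k * (6 * n - 9) <= n * (6 * n - 9))%N by rewrite leq_mul.
nia.
Qed.
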